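(* Let $\Omega$ be a locally compact Hausdorff space, and let $E$ and $F$ be two Hilbert $C_0(\Omega)$-modules. Suppose that $\theta: E \to F$ is an orthogonality preserving local $\mathbb{C}$-linear map (not assumed to be bounded). Then the following assertions hold. (a) $\theta\in \mathcal{B}_{C_0(\Omega)}(E, F)$, i.e. $\theta$ is a bounded $C_0(\Omega)$-module homomorphism. (b) There is a bounded non-negative function $\varphi$ on $\Omega$ which is continuous on $\Omega_E$ such that $$\langle \theta(e), \theta(g) \rangle = \varphi \cdot \langle e, g \rangle, \quad \forall e,g\in E.$$ (c) There exist a strictly positive element $\psi_0\in C_b(\Omega_\theta)_+$ and a map $J\in \mathcal{B}_{C_0(\Omega_\theta)}(E_{\Omega_\theta}, F_{\Omega_\theta})$ such that the fibre map $J_\omega: \Xi^E_\omega\to\Xi^F_\omega$ is an isometry for each $\omega\in \Omega_\theta$ and $$\theta(e)(\omega) = \psi_0(\omega)\, J_\omega(e(\omega)), \quad \forall e\in E,\ \forall \omega\in \Omega_\theta.$$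
   Context: $C_0(\Omega)$ is the $C^*$-algebra of continuous complex-valued functions on $\Omega$ vanishing at infinity. Hilbert $C_0(\Omega)$-modules are right Hilbert $C^*$-modules with $C_0(\Omega)$-valued inner product $\langle\cdot,\cdot\rangle$ satisfying $\langle x,ya\rangle=\langle x,y\rangle a$ and $\langle x,y\rangle^*=\langle y,x\rangle$, complete in the norm $\|x\|=\|\langle x,x\rangle\|^{1/2}$. A map $\theta:E\to F$ is orthogonality preserving if $\langle\theta(x),\theta(y)\rangle=0$ whenever $x,y\in E$ and $\langle x,y\rangle=0$. A $\mathbb{C}$-linear map $\theta$ is local if $\theta(e)a=0$ whenever $e\in E$, $a\in C_0(\Omega)$ and $ea=0$. A $C_0(\Omega)$-module homomorphism is a $\mathbb{C}$-linear map with $\theta(xa)=\theta(x)a$ for all $x\in E$, $a\in C_0(\Omega)$; $\mathcal{B}_{C_0(\Omega)}(E,F)$ is the set of all bounded $C_0(\Omega)$-module homomorphisms from $E$ to $F$. For $\omega\in\Omega$, let $K^E_\omega=\{e\in E:\langle e,e\rangle(\omega)=0\}$. The fibre of $E$ at $\omega$ is the Hilbert space $\Xi^E_\omega=E/K^E_\omega$, with inner product induced by $(e,f)\mapsto\langle e,f\rangle(\omega)$; write $e(\omega)=e+K^E_\omega\in\Xi^E_\omega$. Similarly for $F$. Put $\Omega_E=\{\omega\in\Omega:\Xi^E_\omega\neq(0)\}$ and $\Omega_\theta=\{\omega\in\Omega:\theta(e)(\omega)\neq0\text{ for some }e\in E\}$; the latter is an open subset of $\Omega$. For an open set $\Omega_0\subseteq\Omega$,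 $E_{\Omega_0}=\{e\in E:e(\omega)=0\ \forall\omega\in\Omega\setminus\Omega_0\}$, regarded as a Hilbert $C_0(\Omega_0)$-module, where $C_0(\Omega_0)$ is identified with the functions in $C_0(\Omega)$ vanishing on $\Omega\setminus\Omega_0$. For $\omega\in\Omega_0$ the fibre of $E_{\Omega_0}$ at $\omega$ is canonically identified with $\Xi^E_\omega$. For $J\in\mathcal{B}_{C_0(\Omega_0)}(E_{\Omega_0},F_{\Omega_0})$ and $\omega\in\Omega_0$, the fibre map $J_\omega:\Xi^E_\omega\to\Xi^F_\omega$ is the linear map determined by $J_\omega(e(\omega))=J(e)(\omega)$ for $e\in E_{\Omega_0}$. $C_b(X)_+$ is the set of bounded continuous non-negative real functions on $X$; strictly positive means $>0$ at every point. *)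

(* Defs.v *)
From HB Require Import structures.
From mathcomp Require Import all_boot all_order all_algebra.
From mathcomp Require Import complex.
From mathcomp Require Import all_classical all_reals all_analysis.
From mathcomp Require Import ring.
From mathcomp Require Import ring.
From mathcomp Require Import ring.
From mathcomp Require Import ring.

Set Implicit Arguments.
Unset Strict Implicit.
Unset Printing Implicit Defensive.

Import Order.TTheory GRing.Theory Num.Theory.
Import numFieldNormedType.Exports.

Local Open Scope classical_set_scope.
Local Open Scope ring_scope.
Local Open Scope quotient_scope.

(* The topology (and the modulus `|z| : R[i]) of the complex numbers is carried
   by the alias R[i]^o. *)

Section C0.
Variables (R : realType) (Omega : topologicalType).

Definition vanishes_at_infinity (a : Omega -> R[i]^o) : Prop :=
  forall e : R[i], 0 < e ->
    exists2 K : set Omega, compact K & forall w, ~ K w -> `|a w| < e.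

Definition C0_pred : {pred Omega -> R[i]^o} :=
  fun a => `[< continuous a /\ vanishes_at_infinity a >].

Record C0 := MkC0 { C0_fun :> Omega -> R[i]^o ; C0P : C0_fun \in C0_pred }.

HB.instance Definition _ := [isSub for C0_fun].
HB.instance Definition _ := [Choice of C0 by <:].

Lemma C0_submod_closed : GRing.submod_closed C0_pred.
Proof.
split.
  apply/asboolP; split; first exact: cst_continuous.
  by move=> e e0; exists set0 => [|w _]; [exact: compact0 | rewrite normr0].
move=> k a b /asboolP[ca va] /asboolP[cb vb]; apply/asboolP; split.
  move=> w; apply: (@cvgD R[i] R[i]^o); last exact: cb.
  by apply: (@cvgZl_tmp R[i] R[i]^o); exact: ca.
move=> e e0.
have k0 : 0 < `|k| + 1 :> R[i] by rewrite ltr_wpDl.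
have e20 : 0 < e / 2 by rewrite divr_gt0.
have [Ka cKa Ha] := va (e / 2 / (`|k| + 1)) (divr_gt0 e20 k0).
have [Kb cKb Hb] := vb (e / 2) e20.
exists (Ka `|` Kb) => [|w nK]; first exact: compactU.
have /Ha {}Ha : ~ Ka w by move=> h; apply: nK; left.
have /Hb {}Hb : ~ Kb w by move=> h; apply: nK; right.
rewrite (le_lt_trans (ler_normD _ _))// [ltRHS]splitr ler_ltD// normrZ.
rewrite (@le_trans _ _ ((`|k| + 1) * `|a w|))//.
  by rewrite ler_wpM2r// lerDl.
by rewrite mulrC -ler_pdivlMr// ltW.
Qed.

HB.instance Definition _ :=
  GRing.isSubmodClosed.Build R[i] (Omega -> R[i]^o) C0_pred C0_submod_closed.
HB.instance Definition _ := [SubChoice_isSubLmodule of C0 by <:].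

Lemma C0_pred_mul (a b : C0) : a \* b \in C0_pred.
Proof.
have /asboolP[ca va] := C0P a; have /asboolP[cb vb] := C0P b.
apply/asboolP; split.
  by move=> w; apply: (@cvgM R[i]); [exact: ca | exact: cb].
move=> e e0.
have [Ka cKa Ha] := va 1 ltr01; have [Kb cKb Hb] := vb e e0.
exists (Ka `|` Kb) => [|w nK]; first exact: compactU.
have /Ha {}Ha : ~ Ka w by move=> h; apply: nK; left.
have /Hb {}Hb : ~ Kb w by move=> h; apply: nK; right.
rewrite normrM (le_lt_trans _ Hb)//.
by rewrite -[leRHS]mul1r ler_wpM2r// ltW.
Qed.

Definition C0_mul (a b : C0) : C0 := MkC0 (C0_pred_mul a b).

Definition C0_norm (a : C0) : R :=
  sup [set complex.Re `|a w| | w in [set: Omega]].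

End C0.

(* The scalar norm `|x| of a normedModType over R[i] is a (real) element of
   R[i]. Definiteness of the inner product follows from norm_inner. *)
HB.mixin Record CompleteNormedModule_isHilbertC0Module
    (R : realType) (Omega : topologicalType) E of CompleteNormedModule R[i] E := {
  act : E -> C0 R Omega -> E ;
  inner : E -> E -> C0 R Omega ;
  actDl : forall x y a, act (x + y) a = act x a + act y a ;
  actDr : forall x a b, act x (a + b) = act x a + act x b ;
  actM : forall x a b, act x (C0_mul a b) = act (act x a) b ;
  actZl : forall k x a, act (k *: x) a = k *: act x a ;
  actZr : forall k x a, act x (k *: a) = k *: act x a ;
  innerDr : forall x y z, inner x (y + z) = inner x y + inner x z ;
  innerZr : forall k x y, inner x (k *: y) = k *: inner x y ;
  innerM : forall x y a, inner x (act y a) = C0_mul (inner x y) a ;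
  inner_conj : forall x y w, (inner x y w : R[i])^* = inner y x w ;
  inner_ge0 : forall x w, 0 <= (inner x x w : R[i]) ;
  norm_inner : forall x, `|x| = (Num.sqrt (C0_norm (inner x x)))%:C%C
}.

#[short(type="hilbertC0ModType")]
HB.structure Definition HilbertC0Module (R : realType) (Omega : topologicalType) :=
  { E of CompleteNormedModule R[i] E &
         CompleteNormedModule_isHilbertC0Module R Omega E }.

Section Fibre.
Variables (R : realType) (Omega : topologicalType).
Variables (E : hilbertC0ModType R Omega) (w : Omega).

Let ip (x y : E) : R[i] := inner x y w.

Let ipDr x y z : ip x (y + z) = ip x y + ip x z.
Proof. by rewrite /ip innerDr. Qed.

Let ipZr k x y : ip x (k *: y) = k * ip x y.
Proof. by rewrite /ip innerZr. Qed.

Let ip_conj x y : (ip x y)^* = ip y x.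
Proof. exact: inner_conj. Qed.

Let ip_ge0 x : 0 <= ip x x.
Proof. exact: inner_ge0. Qed.

Let ipDl x y z : ip (x + y) z = ip x z + ip y z.
Proof. by rewrite -!(ip_conj z) ipDr rmorphD. Qed.

Let ipZl k x y : ip (k *: x) y = k^* * ip x y.
Proof. by rewrite -!(ip_conj y) ipZr rmorphM. Qed.

Definition nullspace : {pred E} := fun e => inner e e w == 0.

Let nullspace_ip e f : e \in nullspace -> ip f e = 0.
Proof.
move=> /eqP e0; apply/eqP/negPn/negP => n0.
set s := ip f e in n0; pose N := ip f f.
have N0 : 0 <= N := ip_ge0 f.
have s0 : 0 < s * s^* by rewrite mul_conjC_gt0.
pose t := - ((N + 1) / (s * s^*)).
have tr : t^* = t.
  by apply: conj_Creal; rewrite realN ger0_real// divr_ge0// ?addr_ge0// ltW.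
have := ip_ge0 (f + (t * s^*) *: e).
rewrite ipDr !ipDl !ipZr !ipZl [ip e e]e0 !mulr0 addr0 -(ip_conj f e) -/s -/N.
rewrite rmorphM/= conjCK tr.
rewrite [X in 0 <= X](_ : _ = - (N + 2)).
  by rewrite oppr_ge0 => /(lt_le_trans (ltr_wpDl N0 (ltr0Sn _ 1))); rewrite ltxx.
have -> : N + t * s * s^* + t * s^* * s = N + 2 * (t * (s * s^*)) by ring.
by rewrite /t mulNr divfK ?gt_eqF//; ring.
Qed.

Lemma nullspace_inner (e f : E) : e \in nullspace -> inner f e w = 0.
Proof. exact: nullspace_ip. Qed.

Lemma nullspace_submod_closed : GRing.submod_closed nullspace.
Proof.
split; first by rewrite unfold_in -[inner _ _ _]/(ip 0 0) -(scale0r 0) ipZr mul0r.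
move=> k x y x0 y0; rewrite unfold_in -[inner _ _ _]/(ip _ _).
by rewrite ipDr ipZr !nullspace_ip// mulr0 addr0.
Qed.

HB.instance Definition _ :=
  GRing.isSubmodClosed.Build R[i] E nullspace nullspace_submod_closed.

(* The fibre of E at w, as the quotient of E by nullspace. *)
Definition fibre : Type := Quotient.quot nullspace.

HB.instance Definition _ := GRing.Zmodule.on fibre.
HB.instance Definition _ := EqQuotient.on fibre.

(* The class e(w) of e in the fibre at w. *)
Definition evalf (e : E) : fibre := \pi_fibre e.

Definition fibre_scale (k : R[i]) (u : fibre) : fibre := evalf (k *: repr u).

Lemma evalf_eq (x y : E) : (evalf x == evalf y) = (x - y \in nullspace).
Proof. by rewrite /evalf -Quotient.idealrBE. Qed.

Lemma evalfD (x y : E) : evalf (x + y) = evalf x + evalf y.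
Proof. by rewrite /evalf; exact: Quotient.pi_add. Qed.

Lemma evalfK (u : fibre) : evalf (repr u) = u.
Proof. exact: reprK. Qed.

Lemma evalfZ k (x : E) : evalf (k *: x) = fibre_scale k (evalf x).
Proof.
apply/eqP; rewrite evalf_eq -scalerBr rpredZ// -evalf_eq.
by rewrite evalfK.
Qed.

Lemma fibre_scaleA k l u : fibre_scale k (fibre_scale l u) = fibre_scale (k * l) u.
Proof. by rewrite -(evalfK u) -!evalfZ scalerA. Qed.

Lemma fibre_scale1 : left_id 1 fibre_scale.
Proof. by move=> u; rewrite -(evalfK u) -!evalfZ scale1r. Qed.

Lemma fibre_scaleDr : right_distributive fibre_scale +%R.
Proof.
move=> k u v; rewrite -(evalfK u) -(evalfK v).
by rewrite -evalfD -!evalfZ scalerDr evalfD.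
Qed.

Lemma fibre_scaleDl u : {morph fibre_scale^~ u : k l / k + l}.
Proof.
by move=> k l; rewrite -(evalfK u) -!evalfZ scalerDl evalfD.
Qed.

HB.instance Definition _ := GRing.Zmodule_isLmodule.Build R[i] fibre
  fibre_scaleA fibre_scale1 fibre_scaleDr fibre_scaleDl.

Lemma evalf_is_linear : linear evalf.
Proof. by move=> k x y; rewrite evalfD evalfZ. Qed.

HB.instance Definition _ :=
  GRing.isLinear.Build R[i] E fibre *:%R evalf evalf_is_linear.

Definition fibre_inner (u v : fibre) : R[i] := inner (repr u) (repr v) w.

Lemma fibre_innerE (x y : E) : fibre_inner (evalf x) (evalf y) = inner x y w.
Proof.
have P z : z - repr (evalf z) \in nullspace by rewrite -evalf_eq evalfK.
rewrite /fibre_inner -[LHS]/(ip _ _) -[RHS]/(ip _ _).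
rewrite -{2}(subrK (repr (evalf x)) x) -{2}(subrK (repr (evalf y)) y).
rewrite ipDl -(ip_conj _ (x - _)) (nullspace_ip _ (P x)) conjC0 add0r.
by rewrite ipDr (nullspace_ip _ (P y)) add0r.
Qed.

Definition fibre_norm (u : fibre) : R[i] := sqrtC (fibre_inner u u).

End Fibre.

Section Submodule.
Variables (R : realType) (Omega : topologicalType).
Variables (E : hilbertC0ModType R Omega) (U : set Omega).

Definition vanishing_off : {pred E} :=
  fun e => `[< forall w, ~ U w -> evalf w e = 0 >].

Record submodule :=
  Submodule { submodule_val : E ; submoduleP : submodule_val \in vanishing_off }.

HB.instance Definition _ := [isSub for submodule_val].
HB.instance Definition _ := [Choice of submodule by <:].

Lemma sub_submod_closed : GRing.submod_closed vanishing_off.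
Proof.
split; first by apply/asboolP => w _; rewrite linear0.
move=> k x y /asboolP x0 /asboolP y0; apply/asboolP => w nU.
by rewrite linearP/= x0// y0// scaler0 addr0.
Qed.

HB.instance Definition _ :=
  GRing.isSubmodClosed.Build R[i] E vanishing_off sub_submod_closed.
HB.instance Definition _ := [SubChoice_isSubLmodule of submodule by <:].

Lemma sub_act_subproof (e : submodule) (a : C0 R Omega) :
  act (val e) a \in vanishing_off.
Proof.
have /asboolP e0 := submoduleP e; apply/asboolP => w nU; apply/eqP.
rewrite -(linear0 (evalf w)) evalf_eq subr0 unfold_in innerM /=.
have := e0 _ nU; rewrite -(linear0 (evalf w)) => /eqP; rewrite evalf_eq subr0 => h.
by rewrite (nullspace_inner _ h) mul0r.
Qed.

Definition sub_act (e : submodule) (a : C0 R Omega) : submodule :=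
  Submodule (sub_act_subproof e a).

End Submodule.

Section Maps.
Variables (R : realType) (Omega : topologicalType).
Variables (E F : hilbertC0ModType R Omega).

Definition orthogonality_preserving (theta : {linear E -> F}) : Prop :=
  forall x y : E, inner x y = 0 -> inner (theta x) (theta y) = 0.

Definition local_map (theta : {linear E -> F}) : Prop :=
  forall (e : E) (a : C0 R Omega), act e a = 0 -> act (theta e) a = 0.

(* Membership in B_{C0(Omega)}(E, F). *)
Definition bounded_module_hom (theta : {linear E -> F}) : Prop :=
  (forall (x : E) (a : C0 R Omega), theta (act x a) = act (theta x) a) /\
  exists M : R, forall x : E, `|theta x| <= M%:C%C * `|x|.

(* Membership in B_{C0(U)}(E_U, F_U), where C0(U) is identified with the
   functions of C0(Omega) that vanish off U. *)
Definition bounded_submodule_hom (U : set Omega)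
    (J : {linear submodule E U -> submodule F U}) : Prop :=
  (forall (e : submodule E U) (a : C0 R Omega),
     (forall w, ~ U w -> a w = 0) -> J (sub_act e a) = sub_act (J e) a) /\
  exists M : R, forall e : submodule E U, `|val (J e)| <= M%:C%C * `|val e|.

(* Since {e(w) : e in E_U} is the whole fibre of E at w for U open and w in U,
   this determines the fibre map J_w. *)
Definition is_fibre_map (U : set Omega)
    (J : {linear submodule E U -> submodule F U}) (w : Omega)
    (Jw : {linear fibre E w -> fibre F w}) : Prop :=
  forall e : submodule E U, Jw (evalf w (val e)) = evalf w (val (J e)).

Definition fibre_isometry (w : Omega) (Jw : {linear fibre E w -> fibre F w}) : Prop :=
  forall u v : fibre E w, fibre_norm (Jw u - Jw v) = fibre_norm (u - v).

(* Omega_E *)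
Definition mod_support : set Omega := [set w | exists u : fibre E w, u != 0].

(* Omega_theta *)
Definition map_support (theta : {linear E -> F}) : set Omega :=
  [set w | exists e : E, evalf w (theta e) != 0].

End Maps.

(* Main.v *)
Require Import Defs.
From HB Require Import structures.
From mathcomp Require Import all_boot all_order all_algebra.
From mathcomp Require Import complex.
From mathcomp Require Import all_classical all_reals all_analysis.
From mathcomp Require Import ring lra.

(** A local map kills at [w] every element vanishing near [w].  If [e] only
    vanishes at [w] while [theta e] does not, a sum of disjointly supported
    humps, equal to [2^k e] on plateaus accumulating at [w], has an unbounded
    image; so [theta] acts fibrewise and is [C0]-linear.  For any [e], [g] the
    element [g<e,e> - e<e,g>] is orthogonal to [e], whence
      [<theta e, theta g> <e,e> = <theta e, theta e> <e,g>],
    and the ratio [<theta e, theta e> / <e,e>] does not depend on [e]: it is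
    [phi].  A second gliding hump bounds [phi], and [J] is [theta] divided by
    [sqrt phi]. *)

Import Order.TTheory GRing.Theory Num.Theory.
Import numFieldNormedType.Exports.

Local Open Scope classical_set_scope.
Local Open Scope ring_scope.

Set Implicit Arguments.
Unset Strict Implicit.
Unset Printing Implicit Defensive.

(** * Norms in the fibres, completeness, and construction of elements of [C0] *)

Section pointwise_norm.
Variables (R : realType) (Omega : topologicalType) (E : hilbertC0ModType R Omega).
Implicit Types (x y z : E) (w : Omega) (a : C0 R Omega).

(** Real-valued, so that order and continuity arguments take place in [R]; [inner_sqnorm] recovers
    the complex value. *)
Definition sqnorm x w : R := complex.Re (inner x x w).
Definition ptnorm x w : R := Num.sqrt (sqnorm x w).

Lemma ge0_ReK (z : R[i]) : 0 <= z -> (complex.Re z)%:C%C = z.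
Proof. by move=> z0; rewrite RRe_real// ger0_real. Qed.

Lemma inner_sqnorm x w : inner x x w = (sqnorm x w)%:C%C.
Proof. by rewrite /sqnorm ge0_ReK//; exact: inner_ge0. Qed.

Lemma sqnorm_ge0 x w : 0 <= sqnorm x w.
Proof. by rewrite -ler0c -inner_sqnorm; exact: inner_ge0. Qed.

Lemma ptnorm_ge0 x w : 0 <= ptnorm x w.
Proof. exact: sqrtr_ge0. Qed.

Lemma sqr_ptnorm x w : ptnorm x w ^+ 2 = sqnorm x w.
Proof. by rewrite sqr_sqrtr// sqnorm_ge0. Qed.

Lemma innerDrE x y z w : inner x (y + z) w = inner x y w + inner x z w.
Proof. by rewrite innerDr. Qed.

Lemma innerZrE k x y w : inner x (k *: y) w = k * inner x y w.
Proof. by rewrite innerZr. Qed.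

Lemma innerME x y a w : inner x (act y a) w = inner x y w * a w.
Proof. by rewrite innerM. Qed.

Lemma innerDlE x y z w : inner (x + y) z w = inner x z w + inner y z w.
Proof.
rewrite -(inner_conj z) innerDrE rmorphD/=.
by congr (_ + _); exact: inner_conj.
Qed.

Lemma innerZlE (k : R[i]) x y w : inner (k *: x) y w = k^* * inner x y w.
Proof.
rewrite -(inner_conj y) innerZrE rmorphM/=.
by congr (_ * _); exact: inner_conj.
Qed.

Lemma in_nullspace x w : (x \in nullspace w) = (sqnorm x w == 0).
Proof.
rewrite unfold_in /nullspace inner_sqnorm.
by apply/eqP/eqP => [[]|->].
Qed.

Lemma ptnorm_eq0 x w : (ptnorm x w == 0) = (x \in nullspace w).
Proof. by rewrite in_nullspace -sqr_ptnorm sqrf_eq0. Qed.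

Lemma evalf_eq0 x w : (evalf w x == 0) = (x \in nullspace w).
Proof. by rewrite -(linear0 (evalf w)) evalf_eq subr0. Qed.

Lemma sqnormZ (k : R) x w : sqnorm (k%:C%C *: x) w = k ^+ 2 * sqnorm x w.
Proof.
rewrite /sqnorm innerZrE innerZlE inner_sqnorm.
have -> : (k%:C%C : R[i])^* = k%:C%C by exact: conjc_real.
by rewrite -!rmorphM /= mulrA.
Qed.

Lemma ptnormZ (k : R) x w : ptnorm (k%:C%C *: x) w = `|k| * ptnorm x w.
Proof. by rewrite /ptnorm sqnormZ sqrtrM ?sqr_ge0// sqrtr_sqr. Qed.

Lemma ptnormN x w : ptnorm (- x) w = ptnorm x w.
Proof.
have -> : - x = (-1)%:C%C *: x by rewrite rmorphN rmorph1 scaleN1r.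
by rewrite ptnormZ normrN1 mul1r.
Qed.

Lemma Re_innerC x y w : complex.Re (inner y x w) = complex.Re (inner x y w).
Proof. by rewrite -(inner_conj x); case: (inner x y w : R[i]). Qed.

Lemma sqnormD x y w :
  sqnorm (x + y) w = sqnorm x w + 2 * complex.Re (inner x y w) + sqnorm y w.
Proof.
rewrite /sqnorm innerDrE !innerDlE.
have ReD (u v : R[i]) : complex.Re (u + v) = complex.Re u + complex.Re v.
  by case: u v => ? ? [].
rewrite !ReD (Re_innerC x y); ring.
Qed.

Lemma sqnormB x y w :
  sqnorm (x - y) w = sqnorm x w - 2 * complex.Re (inner x y w) + sqnorm y w.
Proof.
rewrite sqnormD -scaleN1r innerZrE mulN1r -!sqr_ptnorm scaleN1r ptnormN.
have -> : complex.Re (- (inner x y w : R[i])) = - complex.Re (inner x y w).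
  by case: (inner x y w : R[i]).
by rewrite mulrN.
Qed.

(** Cauchy-Schwarz in the fibre, restricted to the real part: this is all that the triangle
    inequality needs. *)
Lemma Re_inner_le x y w :
  complex.Re (inner x y w) <= ptnorm x w * ptnorm y w.
Proof.
set B := complex.Re _.
have [y0|y0] := eqVneq (sqnorm y w) 0.
  by rewrite /B nullspace_inner ?in_nullspace ?y0// mulr_ge0// ptnorm_ge0.
have yp : 0 < sqnorm y w by rewrite lt_def y0 sqnorm_ge0.
(* The minimiser of the quadratic polynomial [sqnorm (x + t *: y) w] in the real variable [t]. *)
pose t := - (B / sqnorm y w).
have := sqnorm_ge0 (x + t%:C%C *: y) w.
rewrite sqnormD sqnormZ innerZrE.
have -> : complex.Re (t%:C%C * (inner x y w : R[i])) = t * B.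
  by rewrite /B; case: (inner x y w : R[i]) => u v /=; rewrite mul0r subr0.
have -> : sqnorm x w + 2 * (t * B) + t ^+ 2 * sqnorm y w
    = sqnorm x w - B ^+ 2 / sqnorm y w by rewrite /t; field.
rewrite subr_ge0 ler_pdivrMr// => BB.
rewrite (le_trans (ler_norm _))// -ler_sqr ?nnegrE ?mulr_ge0 ?ptnorm_ge0//.
by rewrite exprMn !sqr_ptnorm real_normK// num_real.
Qed.

Lemma ptnormD x y w : ptnorm (x + y) w <= ptnorm x w + ptnorm y w.
Proof.
rewrite -ler_sqr ?nnegrE ?addr_ge0 ?ptnorm_ge0// sqr_ptnorm sqnormD.
rewrite sqrrD !sqr_ptnorm; have := Re_inner_le x y w; lra.
Qed.

Lemma ptnormB x y w : ptnorm (x - y) w = ptnorm (y - x) w.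
Proof. by rewrite -ptnormN opprB. Qed.

Lemma ptnorm_dist x y z w :
  ptnorm (x - z) w <= ptnorm (x - y) w + ptnorm (y - z) w.
Proof. by rewrite -[x - z](subrKA y) ptnormD. Qed.

Lemma ptnorm_ler_dist x y w : ptnorm x w - ptnorm (x - y) w <= ptnorm y w.
Proof. by rewrite lerBlDl -{1}(subrK y x) ptnormD. Qed.

Lemma ptnorm_nullB x y w : x - y \in nullspace w -> ptnorm x w = ptnorm y w.
Proof.
rewrite -ptnorm_eq0 => /eqP h; apply/eqP; rewrite eq_le; apply/andP; split.
  by have := ptnorm_ler_dist x y w; rewrite h subr0.
by have := ptnorm_ler_dist y x w; rewrite ptnormB h subr0.
Qed.

Lemma sqnorm_nullB x y w : x - y \in nullspace w -> sqnorm x w = sqnorm y w.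
Proof. by move=> /ptnorm_nullB h; rewrite -!sqr_ptnorm h. Qed.

(** Pairing the difference [z] with itself gives [<z,x>(w) a(w) - a(w) <z,x>(w)]. Hence [a] acts on
    the fibre at [w] as the scalar [a w]. *)
Lemma act_nullB x a w : act x a - a w *: x \in nullspace w.
Proof.
set z := _ - _; rewrite in_nullspace /sqnorm {2}/z -scaleNr innerDrE innerME.
by rewrite innerZrE mulrC mulNr subrr.
Qed.

Lemma evalf_act x a w : evalf w (act x a) = a w *: evalf w x.
Proof. by apply/eqP; rewrite -linearZZ evalf_eq act_nullB. Qed.

Lemma C0_ext (a b : C0 R Omega) : a =1 b -> a = b.
Proof. by move=> ab; apply/val_inj/funext. Qed.

Lemma C0_cvg a w : (a : Omega -> R[i]^o) x @[x --> w] --> a w.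
Proof. by have /asboolP[ca _] := C0P a; exact: ca. Qed.

Lemma continuous_Re : continuous (@complex.Re R : R[i]^o -> R).
Proof.
move=> z; apply/(@cvgrPdist_lt _ _ _ _ (@nbhs_filter R[i]^o z)) => e e0.
have e0' : 0 < e%:C%C :> R[i] by rewrite ltcR.
apply/(@nbhs_ballP R[i] R[i]^o); exists e%:C%C => // u zu.
have {zu} : `|z - u| < e%:C%C by [].
rewrite -ltcR; apply: le_lt_trans.
have -> : complex.Re z - complex.Re u = complex.Re (z - u) by case: z u => ? ? [].
exact: normc_ge_Re.
Qed.

Lemma continuous_sqnorm x : continuous (sqnorm x).
Proof.
move=> w; apply: (@continuous_comp _ _ _ (inner x x : Omega -> R[i]^o)).
  exact: C0_cvg.
exact: continuous_Re.
Qed.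

Lemma sqnorm_small x (e : R) : 0 < e ->
  exists2 K, compact K & forall w, ~ K w -> sqnorm x w < e.
Proof.
move=> e0; have /asboolP[_ va] := C0P (inner x x).
have [|K cK HK] := va e%:C%C; first by rewrite ltcR.
exists K => // w /HK.
by rewrite inner_sqnorm ger0_norm ?ler0c ?sqnorm_ge0// ltcR.
Qed.

Lemma sqnorm_bounded x : exists M, forall w, sqnorm x w <= M.
Proof.
have [K cK HK] := sqnorm_small x ltr01.
have [K0|/set0P K0] := eqVneq K set0.
  by exists 1 => w; apply/ltW/HK; rewrite K0.
have [|c cK' cmax] := @compact_EVT_max _ _ (sqnorm x) _ K0 cK.
  exact/continuous_subspaceT/continuous_sqnorm.
exists (Num.max 1 (sqnorm x c)) => w.
have [Kw|nKw] := pselect (K w); first by rewrite le_max cmax ?orbT// inE.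
by rewrite le_max ltW// HK.
Qed.

Let sqnorm_set x := [set complex.Re `|inner x x w : R[i]^o| | w in [set: Omega]].

Let sqnorm_setE x w : complex.Re `|inner x x w : R[i]^o| = sqnorm x w.
Proof. by rewrite ger0_norm//; exact: inner_ge0. Qed.

Lemma ptnorm_le_norm x w : (ptnorm x w)%:C%C <= `|x|.
Proof.
rewrite norm_inner lecR ler_wsqrtr//; apply: ub_le_sup; last first.
  by exists w => //; exact: sqnorm_setE.
have [M xM] := sqnorm_bounded x.
by exists M => _ [v _ <-]; rewrite sqnorm_setE.
Qed.

Lemma norm_le_ptnorm x (c : R) :
  0 <= c -> (forall w, ptnorm x w <= c) -> `|x| <= c%:C%C.
Proof.
move=> c0 xc; rewrite norm_inner lecR -(ger0_norm c0) -sqrtr_sqr ler_wsqrtr//.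
rewrite /C0_norm -/(sqnorm_set x).
(* The set is empty when [Omega] is; its [sup] is then [0] by convention. *)
have [->|/set0P S0] := eqVneq (sqnorm_set x) set0; first by rewrite sup0 sqr_ge0.
apply: ge_sup => // _ [w _ <-]; rewrite sqnorm_setE -sqr_ptnorm.
by rewrite ler_sqr ?nnegrE ?ptnorm_ge0.
Qed.

(** The norm is controlled by the fibre norms, so equality in [E] can be tested fibre by fibre. *)
Lemma eq_null x y : (forall w, x - y \in nullspace w) -> x = y.
Proof.
move=> h; apply/eqP; rewrite -subr_eq0 -normr_eq0 eq_le normr_ge0 andbT.
by apply: norm_le_ptnorm => // w; rewrite le_eqVlt ptnorm_eq0 h.
Qed.

Lemma evalf_inj x y : (forall w, evalf w x = evalf w y) -> x = y.
Proof. by move=> h; apply: eq_null => w; rewrite -evalf_eq h. Qed.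

(** Increments dominated by those of [b] telescope, so [s] is Cauchy and [b n] bounds the whole tail
    after [s n]. This explicit tail bound is what the gliding humps use. *)
Lemma ptnorm_complete (s : nat -> E) (b : nat -> R) :
  (forall n, 0 <= b n) -> (forall n, b n.+1 <= b n) ->
  (forall e, 0 < e -> exists n, b n < e) ->
  (forall n w, ptnorm (s n.+1 - s n) w <= b n - b n.+1) ->
  exists x, forall n w, ptnorm (x - s n) w <= b n.
Proof.
move=> b0 bS bcv sS.
have tele n k w : ptnorm (s (n + k)%N - s n) w <= b n - b (n + k)%N.
  elim: k => [|k IH].
    by rewrite addn0 !subrr -(scale0r 0) (ptnormZ 0) normr0 mul0r.
  rewrite addnS (le_trans (ptnorm_dist _ (s (n + k)%N) _ _))//.
  by have := sS (n + k)%N w; lra.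
have near_s n m w : (n <= m)%N -> ptnorm (s m - s n) w <= b n.
  by move=> /subnKC <-; rewrite (le_trans (tele _ _ _))// gerBl.
have cs : cauchy (s @ \oo).
  apply: cauchy_exP => e e0.
  have /bcv[n bn] : 0 < complex.Re e by move: e0; rewrite ltcE => /andP[].
  exists (s n); exists n => // m /= nm; rewrite -ball_normE /= distrC.
  rewrite -(ge0_ReK (ltW e0)).
  apply: (@le_lt_trans _ _ (b n)%:C%C); last by rewrite ltcR.
  by apply: norm_le_ptnorm => // w; exact: near_s.
have /cvg_ex[x sx] : cvg (s @ \oo) by apply/cauchy_cvgP.
exists x => n w; apply/ler_addgt0Pr => e e0.
have e0' : 0 < e%:C%C :> R[i] by rewrite ltcR.
have [N _ HN] := @cvgr_dist_lt _ _ _ _ _ _ _ sx _ e0'.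
have xs : ptnorm (x - s (maxn n N)) w <= e.
  rewrite -lecR (le_trans (ptnorm_le_norm _ _))// ltW//.
  by apply: HN; rewrite /= leq_maxr.
have := ptnorm_dist x (s (maxn n N)) (s n) w.
have := near_s n _ w (leq_maxl n N); lra.
Qed.

Lemma geometric_small (c e : R) : 0 < c -> 0 < e -> exists n, c * 2^-1 ^+ n < e.
Proof.
move=> c0 e0; exists (Num.truncn (c / e)).
rewrite exprVn ltr_pdivrMr ?exprn_gt0// mulrC -ltr_pdivrMr//.
rewrite (lt_le_trans (truncnS_gt _))// -natrX ler_nat.
by rewrite (leq_trans _ (ltn_expl _ _)).
Qed.

(** Only the class of [v w] in the fibre at [w] matters: a field of vectors that is a uniform limit
    of elements of [E] comes from an element of [E]. *)
Lemma uniform_section (v : Omega -> E) :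
  (forall e, 0 < e -> exists y, forall w, ptnorm (y - v w) w <= e) ->
  exists x, forall w, x - v w \in nullspace w.
Proof.
move=> approx.
pose q n : R := 2^-1 ^+ n.
have q0 n : 0 < q n by rewrite exprn_gt0.
(* Two consecutive errors add up to [q n / 4 + q n / 8], which is below [q n - q n.+1 = q n / 2]. *)
have /choice[s sP] n := approx _ (q0 n.+2).
have qS n : q n.+1 = q n / 2 by rewrite /q exprSr.
have qsmall e : 0 < e -> exists n, q n < e.
  by move=> /(geometric_small ltr01)[n]; rewrite mul1r => ?; exists n.
have [|n|//|n w|x xs] := @ptnorm_complete s q.
- by move=> n; exact/ltW.
- by rewrite qS; have := q0 n; lra.
- have h1 := sP n w; have h2 := sP n.+1 w.
  rewrite ptnormB in h1.
  have := ptnorm_dist (s n.+1) (v w) (s n) w; move: h1 h2.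
  by rewrite !qS; have := q0 n; lra.
exists x => w; rewrite -ptnorm_eq0 eq_le ptnorm_ge0 andbT.
apply/ler_addgt0Pr => e /[dup] e0 /divr_gt0/(_ (ltr0Sn _ 1))/qsmall[n qn].
have := ptnorm_dist x (s n) (v w) w.
have := xs n w; have := sP n w; have := q0 n; rewrite !qS; lra.
Qed.

(** Domination by a multiple of [sqnorm x] forces [f] to vanish at infinity. Every multiplier below
    is built in this way. *)
Lemma C0_real x (f : Omega -> R) (C : R) : continuous f ->
  (forall w, `|f w| <= C * sqnorm x w) ->
  exists a : C0 R Omega, forall w, a w = (f w)%:C%C.
Proof.
move=> cf fC.
suff fP : (fun w => (f w)%:C%C : R[i]^o) \in @C0_pred R Omega by exists (MkC0 fP).
have normC (r : R) : `|r%:C%C : R[i]^o| = (`|r|)%:C%C.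
  by rewrite [LHS]normc_def /= expr0n addr0 sqrtr_sqr.
apply/asboolP; split.
  move=> w; apply/(@cvgrPdist_lt _ R[i]^o) => e e0.
  rewrite near_simpl -(ge0_ReK (ltW e0)).
  have {}e0 : 0 < complex.Re e by move: e0; rewrite ltcE => /andP[].
  near=> u; rewrite -rmorphB normC ltcR; near: u.
  by have /cvgrPdist_lt/(_ _ e0) := cf w.
move=> e e0; rewrite -(ge0_ReK (ltW e0)).
have {}e0 : 0 < complex.Re e by move: e0; rewrite ltcE => /andP[].
have C1 : 0 < `|C| + 1 by rewrite ltr_wpDl.
have [K cK HK] := sqnorm_small x (divr_gt0 e0 C1).
exists K => // w /HK; rewrite normC ltcR ltr_pdivlMr//.
apply: le_lt_trans; rewrite (le_trans (fC w))// mulrC ler_wpM2l ?sqnorm_ge0//.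
by rewrite (le_trans (ler_norm _))// lerDl.
Unshelve. all: by end_near. Qed.

End pointwise_norm.

(** * A trapezoidal cut-off function *)

Section bump.
Variable R : realType.

(** Since the function lives on the interval from [1] to [16], the dilates [bump (16 ^+ k * t)] for
    distinct [k] have disjoint non-zero sets. *)
Definition bump (t : R) : R := Num.max 0 (Num.min 1 (Num.min (t - 1) (16 - t))).

Lemma bump_ge0 t : 0 <= bump t.
Proof. by rewrite le_max lexx. Qed.

Lemma bump_le1 t : bump t <= 1.
Proof. by rewrite ge_max ler01 ge_min lexx. Qed.

Lemma bump_eq0 t : (t <= 1) || (16 <= t) -> bump t = 0.
Proof.
move=> h; apply/eqP; rewrite eq_le bump_ge0 andbT ge_max lexx/= !ge_min.
by apply/orP; right; rewrite !subr_le0.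
Qed.

Lemma bump_eq1 t : 2 < t < 15 -> bump t = 1.
Proof.
move=> /andP[t1 t2]; apply/eqP; rewrite eq_le bump_le1/= le_max !le_min lexx/=.
by apply/orP; right; apply/andP; split; lra.
Qed.

Lemma bump_le_id t : 0 <= t -> bump t <= t.
Proof.
move=> t0; have [t1|/ltW t1] := leP t 1; first by rewrite bump_eq0 ?t1.
exact: le_trans (bump_le1 t) t1.
Qed.

Lemma continuous_bump : continuous bump.
Proof.
move=> t; have cid : {for t, continuous (fun u : R => u : R^o)} by exact: cvg_id.
have ccst (c : R) : {for t, continuous (fun=> c : R^o)} by exact: cvg_cst.
exact: (continuous_max (ccst 0) (continuous_min (ccst 1)
  (continuous_min (continuousB cid (ccst 1)) (continuousB (ccst 16) cid)))).
Qed.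

End bump.

(** * The sum of disjointly supported humps *)

Section plateau.
Variables (R : realType) (Omega : topologicalType) (E : hilbertC0ModType R Omega).

(** The element is the sum over [k] of [2^k e bump(16^k <e,e>)]. Where the [k]-th term is non-zero,
    [ptnorm e] is at most [4 / 4^k], so the term is at most [4 / 2^k] and the series converges; on
    the [k]-th plateau the other terms vanish. *)
Lemma plateau_element (e : E) : exists x : E, forall k w,
  2 < 16 ^+ k * sqnorm e w < 15 -> x - (2 ^+ k)%:C%C *: e \in nullspace w.
Proof.
have /choice[a aE] (k : nat) : exists a : C0 R Omega,
    forall w, a w = (bump (16 ^+ k * sqnorm e w))%:C%C.
  apply: (@C0_real _ _ _ e _ (16 ^+ k)) => w.
    apply: (@continuous_comp _ _ _ (fun v => 16 ^+ k * sqnorm e v)).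
      by apply: cvgM; [exact: cvg_cst | exact: continuous_sqnorm].
    exact: continuous_bump.
  rewrite ger0_norm ?bump_ge0// bump_le_id// mulr_ge0 ?sqnorm_ge0//.
pose u k := (2 ^+ k)%:C%C *: act e (a k).
pose s n := \sum_(k < n) u k.
(* The sum of the bounds [4 / 2^k] over all [k >= n]. *)
pose b n : R := 8 * 2^-1 ^+ n.
have act_bump k w :
    act e (a k) - (bump (16 ^+ k * sqnorm e w))%:C%C *: e \in nullspace w.
  by rewrite -aE act_nullB.
have b0 n : 0 < b n by rewrite mulr_gt0// exprn_gt0.
have bS n : b n.+1 = b n / 2 by rewrite /b exprSr; ring.
have [|n|e' e'0|n w|x xs] := @ptnorm_complete _ _ _ s b.
- by move=> n; exact/ltW.
- by rewrite bS; have := b0 n; lra.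
- exact: geometric_small.
- have -> : s n.+1 - s n = u n by rewrite /s big_ord_recr/= addrAC subrr add0r.
  rewrite ptnormZ (ptnorm_nullB (act_bump _ _)) ptnormZ.
  rewrite bS (_ : b n - b n / 2 = 4 * 2^-1 ^+ n); last by rewrite /b; field.
  rewrite ger0_norm ?exprn_ge0// ger0_norm ?bump_ge0//.
  have [h|] := boolP ((16 ^+ n * sqnorm e w <= 1) || (16 <= 16 ^+ n * sqnorm e w)).
    by rewrite bump_eq0// mul0r mulr0 mulr_ge0// exprn_ge0.
  rewrite negb_or -!ltNge => /andP[_ h].
  have {}h : 4 ^+ n * ptnorm e w <= 4.
    rewrite -ler_sqr ?nnegrE ?mulr_ge0 ?ptnorm_ge0 ?exprn_ge0//.
    rewrite exprMn sqr_ptnorm -exprM mulnC exprM.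
    rewrite (_ : 4 ^+ 2 = 16); last by rewrite -natrX.
    exact: ltW.
  rewrite exprVn ler_pdivlMr ?exprn_gt0//.
  apply: le_trans h; rewrite (_ : 4 = 2 * 2) ?exprMn; last by rewrite -natrM.
  rewrite mulrAC -!mulrA !ler_wpM2l ?exprn_ge0//.
  by rewrite ler_piMl ?ptnorm_ge0 ?bump_le1.
exists x => k w kw.
have s_plateau n : (k < n)%N -> s n - (2 ^+ k)%:C%C *: e \in nullspace w.
  move=> kn; rewrite /s (bigD1 (Ordinal kn))//= addrAC; apply: rpredD.
    rewrite /u -scalerBr rpredZ//; have := act_bump k w.
    by rewrite bump_eq1// scale1r.
  apply: rpred_sum => j jk; rewrite rpredZ//; have := act_bump j w.
  have {}jk : (j < k)%N || (k < j)%N.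
    by rewrite -neq_ltn; apply: contra jk => /eqP jk; apply/eqP/val_inj.
  rewrite bump_eq0 ?scale0r ?subr0//.
  (* A change of index multiplies or divides the argument by at least [16], which moves a value
     between [2] and [15] out of the support of [bump]. *)
  have grow m l : (m < l)%N -> 16 * (16 ^+ m * sqnorm e w) <= 16 ^+ l * sqnorm e w.
    move=> ml; rewrite mulrA -exprS ler_wpM2r ?sqnorm_ge0//.
    by rewrite ler_weXn2l// ler1n.
  case/andP: kw => k1 k2; case/orP: jk => /grow h; apply/orP; [left|right]; lra.
rewrite -ptnorm_eq0 eq_le ptnorm_ge0 andbT; apply/ler_addgt0Pr => d d0.
have [n bn] := geometric_small (ltr0Sn R 7) d0.
have [m km nm] : exists2 m, (k < m)%N & (n <= m)%N.
  by exists (maxn k.+1 n); rewrite ?leq_maxl ?leq_maxr.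
have := ptnorm_dist x (s m) ((2 ^+ k)%:C%C *: e) w.
move: (s_plateau _ km); rewrite -ptnorm_eq0 => /eqP ->; have := xs m w.
suff : b m <= b n by rewrite /b in bn *; lra.
by rewrite /b ler_wpM2l// ler_wiXn2l//; lra.
Qed.

End plateau.

(** * Local maps act fibrewise *)

Section local_maps.
Variables (R : realType) (Omega : topologicalType).
Hypotheses (Omega_lc : locally_compact [set: Omega]) (Omega_T2 : hausdorff_space Omega).
Variables (E F : hilbertC0ModType R Omega) (theta : {linear E -> F}).
Hypothesis theta_local : local_map theta.

(** A function supported where [e] vanishes and non-zero at [w] kills [e], hence kills [theta e] by
    locality. *)
Lemma local_near_null (e : E) w :
  (\forall v \near w, e \in nullspace v) -> theta e \in nullspace w.
Proof.
move=> h; have : nbhs w [set v | e \in nullspace v] := h.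
rewrite nbhsE => -[U [oU Uw] Ue].
have /(@uniform_separatorP _ R)[f [cf f01 f0 f1]] : uniform_separator [set w] (~` U).
  apply: (@locally_compact_completely_regular _ R Omega_lc Omega_T2).
    exact: open_closedC.
  exact.
(* The factor [sqnorm (theta e)] makes the multiplier vanish at infinity. At [w] the multiplier
   equals [sqnorm (theta e) w], so killing [theta e] there still forces it to be null. *)
have [v|v|a aE] := @C0_real _ _ _ (theta e) (fun v => (1 - f v) * sqnorm (theta e) v) 1.
- apply: cvgM; last exact: continuous_sqnorm.
  by apply: cvgB; [exact: cvg_cst | exact: cf].
- have /f01 /= : range f (f v) by exists v.
  rewrite in_itv/= => /andP[fv0 fv1]; rewrite ger0_norm.
    by rewrite ler_wpM2r ?sqnorm_ge0// gerBl.
  by rewrite mulr_ge0 ?sqnorm_ge0// subr_ge0.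
have ea : act e a = 0.
  apply: eq_null => v; rewrite subr0 -[act e a](subrK (a v *: e)).
  rewrite rpredD ?act_nullB// aE.
  have [/Ue ev|nUv] := pselect (U v); first exact: rpredZ.
  have -> : f v = 1 by apply: f1; exists v.
  by rewrite subrr mul0r scale0r rpred0.
have := act_nullB (theta e) a w; rewrite theta_local// sub0r rpredN aE.
have -> : f w = 0 by apply: f0; exists w.
rewrite subr0 mul1r !in_nullspace sqnormZ.
by rewrite mulf_eq0 sqrf_eq0 orbb.
Qed.

(* Near a point outside its interior, the zero set of [e] is accumulated by
   points where [e] is small but non-zero; there [theta (plateau element)] is
   a large multiple of [theta e], contradicting boundedness. The plateaus of
   [e] and of [2 e] together cover all small values of [sqnorm e]. *)
Lemma local_null (e : E) w : e \in nullspace w -> theta e \in nullspace w.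
Proof.
rewrite !in_nullspace => /eqP ew; apply/negPn/negP => tew.
pose P := sqnorm (theta e); pose d := P w / 2.
have d0 : 0 < d by rewrite divr_gt0// lt_def tew sqnorm_ge0.
have [x1 x1P] := plateau_element e.
have [x2 x2P] := plateau_element (2%:C%C *: e).
have [M1 HM1] := sqnorm_bounded (theta x1).
have [M2 HM2] := sqnorm_bounded (theta x2).
pose M := Num.max M1 M2.
(* The plateau condition is open in [v], so [x - y] is null near [v] and [local_near_null] applies.
   The factor [c] is [1] for [e] and [4] for [2 e]. *)
have transfer (x y : E) (k : nat) v (c : R) :
    (forall v, 2 < 16 ^+ k * (c * sqnorm e v) < 15 -> x - y \in nullspace v) ->
    2 < 16 ^+ k * (c * sqnorm e v) < 15 ->
    sqnorm (theta x) v = sqnorm (theta y) v.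
  move=> h /andP[v1 v2]; apply: sqnorm_nullB; rewrite -linearB.
  apply: local_near_null.
  have ck : {for v, continuous (fun v => 16 ^+ k * (c * sqnorm e v))}.
    apply: cvgM; first exact: cvg_cst.
    by apply: cvgM; [exact: cvg_cst | exact: continuous_sqnorm].
  near=> u; apply: h; apply/andP; split; near: u.
    exact: (cvgr_gt _ ck).
  exact: (cvgr_lt _ ck).
have cP : {for w, continuous P} by exact: continuous_sqnorm.
have ce : {for w, continuous (sqnorm e)} by exact: continuous_sqnorm.
have [k0 Hk0] : exists k0 : nat, M < 4 ^+ k0 * d.
  have M_gt0 : 0 < `|M| + 1 by rewrite ltr_wpDl.
  have [k0 hk] := geometric_small M_gt0 d0; exists k0.
  rewrite (le_lt_trans (ler_norm _))// (@lt_le_trans _ _ (`|M| + 1)) ?ltrDl//.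
  move: hk; rewrite exprVn ltr_pdivrMr ?exprn_gt0// => /ltW /le_trans; apply.
  rewrite mulrC ler_wpM2r ?(ltW d0)// lerXn2r ?nnegrE//; lra.
have small : 0 < 16^-1 ^+ k0 * (3/4) :> R by rewrite mulr_gt0 ?exprn_gt0//; lra.
(* Otherwise [e] would be null at all points near [w], where [P] exceeds [d] and [sqnorm e] is
   small, and [theta e] would be null at [w]. *)
have [v [ev0 ev1 Pv]] : exists v,
    [/\ 0 < sqnorm e v, 16 ^+ k0 * sqnorm e v < 3/4 & d < P v].
  apply: contrapT => /forallNP h.
  suff : theta e \in nullspace w by rewrite in_nullspace (negbTE tew).
  apply: local_near_null; near=> v.
  rewrite in_nullspace; apply/negPn/negP => ev; apply: (h v); split.
  - by rewrite lt_def ev sqnorm_ge0.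
  - rewrite mulrC -ltr_pdivlMr ?exprn_gt0// mulrC -exprVn; near: v.
    by apply: (cvgr_lt _ ce); rewrite ew.
  - near: v; apply: (cvgr_gt _ cP).
    by rewrite /d ltr_pdivrMr// ltr_pMr ?ltr1n// lt_def tew sqnorm_ge0.
have exk : exists k : nat, 3/4 <= 16 ^+ k * sqnorm e v.
  have [k hk] := geometric_small (ltr01 : 0 < 1 :> R) ev0; exists k.
  move: hk; rewrite mul1r exprVn invf_plt ?posrE ?exprn_gt0// => hk.
  rewrite (@le_trans _ _ 1)//; first lra.
  rewrite -ler_pdivrMr// mul1r ltW// (lt_le_trans hk)// lerXn2r ?nnegrE//; lra.
(* Minimality places [16 ^+ k * sqnorm e v] between [3/4] and [12 = 16 * 3/4]. *)
case: (ex_minnP exk) => k k1 kmin.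
have kk0 : (k0 < k)%N.
  rewrite ltnNge; apply/negP => kk0.
  have : 16 ^+ k * sqnorm e v <= 16 ^+ k0 * sqnorm e v.
    by rewrite ler_wpM2r ?sqnorm_ge0// ler_weXn2l// ler1n.
  lra.
have k2 : 16 ^+ k * sqnorm e v < 12.
  have : 16 ^+ k.-1 * sqnorm e v < 3/4.
    by rewrite ltNge; apply/negP => /kmin; rewrite leqNgt ltn_predL (leq_trans _ kk0).
  case: (k) kk0 => // m _ /=; rewrite exprS; lra.
have big : M < 4 ^+ k * P v.
  apply: (lt_le_trans Hk0); apply: ler_pM; rewrite ?exprn_ge0 ?(ltW d0) ?(ltW Pv)//.
  by rewrite ler_weXn2l ?ler1n// ltnW.
have pow : (2 ^+ k) ^+ 2 = 4 ^+ k :> R.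
  by rewrite -exprM mulnC exprM; congr (_ ^+ _); ring.
have M1M : M1 <= M by rewrite le_max lexx.
have M2M : M2 <= M by rewrite le_max lexx orbT.
have P0 : 0 <= 4 ^+ k * P v by rewrite mulr_ge0 ?exprn_ge0 ?sqnorm_ge0.
have sqr2 : 2 ^+ 2 = 4 :> R by rewrite -natrX.
(* Above [2], the point [v] lies on a plateau of [e]; otherwise the value lies between [3/4] and
   [2], and four times it lies between [3] and [8], on a plateau of [2 e]. *)
have [v2|v2] := ltP 2 (16 ^+ k * sqnorm e v).
  have : sqnorm (theta x1) v = 4 ^+ k * P v.
    rewrite (@transfer x1 ((2 ^+ k)%:C%C *: e) k v 1) => [|u|].
    - by rewrite linearZZ sqnormZ pow.
    - by rewrite mul1r; exact: x1P.
    - by rewrite mul1r; apply/andP; split; lra.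
  by have := HM1 v; lra.
have : sqnorm (theta x2) v = 4 * (4 ^+ k * P v).
  rewrite (@transfer x2 ((2 ^+ k)%:C%C *: (2%:C%C *: e)) k v 4) => [|u hu|].
  - by rewrite linearZZ linearZZ sqnormZ sqnormZ pow sqr2 mulrCA.
  - by apply: x2P; rewrite sqnormZ sqr2.
  - by apply/andP; split; lra.
by have := HM2 v; lra.
Unshelve. all: by end_near. Qed.

End local_maps.

(** * The scaling factor of an orthogonality preserving fibrewise map *)

Section fibrewise_maps.
Variables (R : realType) (Omega : topologicalType).
Variables (E F : hilbertC0ModType R Omega) (theta : {linear E -> F}).
Hypothesis theta_null : forall (e : E) w, e \in nullspace w -> theta e \in nullspace w.
Hypothesis theta_orth : orthogonality_preserving theta.

Lemma fibrewise_act (x : E) a : theta (act x a) = act (theta x) a.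
Proof.
apply: eq_null => w.
have := theta_null (act_nullB x a w); rewrite linearB linearZZ => h1.
rewrite -[X in X - _](subrK (a w *: theta x)) -addrA rpredD//.
by rewrite -opprB rpredN act_nullB.
Qed.

Lemma orth_inner (e g : E) w :
  inner (theta e) (theta g) w * inner e e w = inner (theta e) (theta e) w * inner e g w.
Proof.
(* Gram-Schmidt cleared of its denominator [<e,e>]. *)
pose g' := act g (inner e e) - act e (inner e g).
have eg' : inner e g' = 0.
  apply: C0_ext => v; rewrite /g' -scaleN1r innerDrE innerZrE !innerME.
  by rewrite mulN1r mulrC subrr.
have := theta_orth eg'; rewrite /g' linearB !fibrewise_act.
move=> /(congr1 (fun a : C0 R Omega => a w)).
rewrite -scaleN1r innerDrE innerZrE !innerME mulN1r => /eqP.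
by rewrite subr_eq0 => /eqP.
Qed.

(** If [e] and [f] are not orthogonal at [w], [orth_inner] used in both orders gives the equality.
    If they are, both are compared with [e + f], which is orthogonal to neither. *)
Lemma ratio_const (e f : E) w : sqnorm e w != 0 -> sqnorm f w != 0 ->
  sqnorm (theta e) w / sqnorm e w = sqnorm (theta f) w / sqnorm f w.
Proof.
have nonorth (x y : E) : sqnorm x w != 0 -> sqnorm y w != 0 -> inner x y w != 0 ->
    sqnorm (theta x) w / sqnorm x w = sqnorm (theta y) w / sqnorm y w.
  move=> x0 y0 xy; apply/eqP; rewrite eqr_div//; apply/eqP.
  apply: complexI; apply: (mulIf xy); rewrite !rmorphM/= -!inner_sqnorm.
  have h : inner (theta x) (theta y) w * inner y y w
      = inner (theta y) (theta y) w * inner x y w.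
    have /(congr1 (fun z : R[i] => z^*)) := orth_inner y x w.
    by rewrite !rmorphM/= !inner_conj.
  by rewrite mulrAC -orth_inner -mulrA [_ w * inner y y w in LHS]mulrC mulrA h mulrAC.
move=> e0 f0; have [ef|] := eqVneq (inner e f w : R[i]) 0; last exact: nonorth.
have ef0 : sqnorm (e + f) w != 0.
  by rewrite sqnormD ef mulr0 addr0 gt_eqF// addr_gt0// lt_def ?e0 ?f0 sqnorm_ge0.
rewrite (nonorth e (e + f))// ?(nonorth f (e + f))//.
  rewrite innerDrE -(inner_conj e) ef conjC0 add0r inner_sqnorm.
  by rewrite (inj_eq (@complexI _) _ 0).
by rewrite innerDrE ef addr0 inner_sqnorm (inj_eq (@complexI _) _ 0).
Qed.

(** Where the fibre of [E] is zero, [xget] has nothing to choose, the denominator is [0], and the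
    value is [0] by the convention on inverses. *)
Definition scaling w : R :=
  let e := xget 0 [set e : E | sqnorm e w != 0] in sqnorm (theta e) w / sqnorm e w.

Lemma scaling_ge0 w : 0 <= scaling w.
Proof. by rewrite divr_ge0 ?sqnorm_ge0. Qed.

Lemma scalingE (e : E) w : sqnorm e w != 0 ->
  scaling w = sqnorm (theta e) w / sqnorm e w.
Proof.
move=> e0; apply: ratio_const => //.
by case: xgetP => [//|h]; case: (h e e0).
Qed.

Lemma scaling_neq0 w : scaling w != 0 -> exists e : E, sqnorm e w != 0.
Proof.
move=> h; exists (xget 0 [set e : E | sqnorm e w != 0]); apply: contra_neq h => h.
by rewrite /scaling h invr0 mulr0.
Qed.

Lemma inner_scaling (e g : E) w :
  inner (theta e) (theta g) w = (scaling w)%:C%C * inner e g w.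
Proof.
have [e0|e0] := eqVneq (sqnorm e w) 0.
  have en : e \in nullspace w by rewrite in_nullspace e0.
  rewrite -(inner_conj g) -(inner_conj (theta g)) !nullspace_inner//.
    by rewrite conjC0 mulr0.
  exact: theta_null.
have e0' : (inner e e w : R[i]) != 0.
  by rewrite inner_sqnorm (inj_eq (@complexI _) _ 0).
apply: (mulIf e0'); rewrite orth_inner (scalingE e0) !inner_sqnorm mulrAC -rmorphM/=.
by rewrite divfK.
Qed.

Lemma sqnorm_scaling (e : E) w : sqnorm (theta e) w = scaling w * sqnorm e w.
Proof.
apply: complexI; rewrite rmorphM/= -!inner_sqnorm; exact: inner_scaling.
Qed.

(** The same [e] stays non-null near [w], so [scaling] is there a quotient of two continuous
    functions. *)
Lemma continuous_scaling (e : E) w : sqnorm e w != 0 -> {for w, continuous scaling}.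
Proof.
move=> e0.
apply: (@cvg_trans _ ((fun v => sqnorm (theta e) v / sqnorm e v) @ w)).
  apply: near_eq_cvg.
  have e_gt0 : 0 < sqnorm e w by rewrite lt_def e0 sqnorm_ge0.
  near=> v; rewrite (@scalingE e)// gt_eqF//; near: v.
  exact: (cvgr_gt _ (@continuous_sqnorm _ _ _ e w)).
rewrite (scalingE e0); apply: cvgM; first exact: continuous_sqnorm.
by apply: cvgV => //; exact: continuous_sqnorm.
Unshelve. all: by end_near. Qed.

(** After normalisation at [w], multiplication by [2N / (1 + N^2)] with [N = sqnorm y] fixes the
    norm where [N = 1] and turns [N] into [4N^3 / (1 + N^2)^2], which is at most [4]. *)
Lemma normalized_element (e : E) w : sqnorm e w != 0 ->
  exists x : E, ptnorm x w = 1 /\ forall v, ptnorm x v <= 2.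
Proof.
move=> e0; pose y := (ptnorm e w)^-1%:C%C *: e.
have yw : sqnorm y w = 1.
  by rewrite sqnormZ exprVn sqr_ptnorm mulVf.
have den v : 0 < 1 + sqnorm y v ^+ 2 by rewrite ltr_wpDr ?sqr_ge0.
have [v|v|a aE] := @C0_real _ _ _ y (fun v => 2 * sqnorm y v / (1 + sqnorm y v ^+ 2)) 2.
- apply: cvgM.
    by apply: cvgM; [exact: cvg_cst | exact: continuous_sqnorm].
  apply: cvgV; first by rewrite gt_eqF.
  apply: cvgD; first exact: cvg_cst.
  by rewrite expr2; apply: cvgM; exact: continuous_sqnorm.
- have N0 := sqnorm_ge0 y v.
  rewrite ger0_norm ?divr_ge0 ?mulr_ge0 ?(ltW (den v))//.
  by rewrite ler_pdivrMr// ler_peMr ?mulr_ge0// lerDl sqr_ge0.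
exists (act y a).
have sq v : sqnorm (act y a) v
    = (2 * sqnorm y v / (1 + sqnorm y v ^+ 2)) ^+ 2 * sqnorm y v.
  by rewrite (sqnorm_nullB (act_nullB y a v)) aE sqnormZ.
split=> [|v].
  rewrite /ptnorm sq yw (_ : _ * _ = 1) ?sqrtr1//; by field.
rewrite -ler_sqr ?nnegrE ?ptnorm_ge0// sqr_ptnorm sq.
have N0 := sqnorm_ge0 y v; set N := sqnorm y v in N0 *.
rewrite expr_div_n mulrAC ler_pdivrMr ?exprn_gt0//; nra.
Qed.

(** The cross terms of [sqnorm (x + y)] and [sqnorm (x - y)] are opposite, so one of them is
    non-negative. *)
Lemma ptnorm_sign (x y : E) w :
  (ptnorm y w <= ptnorm (x + y) w) || (ptnorm y w <= ptnorm (x - y) w).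
Proof.
have sq (u v : E) : (ptnorm u w <= ptnorm v w) = (sqnorm u w <= sqnorm v w).
  by rewrite -ler_sqr ?nnegrE ?ptnorm_ge0// !sqr_ptnorm.
rewrite !sq sqnormD sqnormB.
have := sqnorm_ge0 x w; set B := complex.Re _; move=> x0.
by case: (lerP 0 B) => B0; apply/orP; [left|right]; lra.
Qed.

(* Sliding hump: [x] is a sum of [+/- 4^-n e_n] with [e_n] of norm [1] at a
   point [w_n] where [scaling] exceeds [64^n]; the signs are chosen so that
   later terms cannot cancel the [n]-th one at [w_n]. *)
Lemma scaling_bounded : exists M, forall w, scaling w <= M.
Proof.
apply: contrapT => /forallNP unb.
have /choice[p pP] (n : nat) : exists p : Omega * E,
    [/\ (4 ^+ n) ^+ 3 < scaling p.1, ptnorm p.2 p.1 = 1 & forall v, ptnorm p.2 v <= 2].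
  have /existsNP[w /negP] := unb ((4 ^+ n) ^+ 3); rewrite -ltNge => hw.
  have [e e0] : exists e : E, sqnorm e w != 0.
    by apply: scaling_neq0; rewrite gt_eqF// (le_lt_trans _ hw)// !exprn_ge0.
  by have [x [xw x2]] := normalized_element e0; exists (w, x).
pose q n : R := (4 ^+ n)^-1.
have q0 n : 0 < q n by rewrite invr_gt0 exprn_gt0.
have qS n : q n.+1 = q n / 4 by rewrite /q exprSr invfM.
pose y n := (q n)%:C%C *: (p n).2.
pose s n := iteri n (fun k x =>
    if ptnorm (y k) (p k).1 <= ptnorm (x + y k) (p k).1
    then x + y k else x - y k) (0 : E).
have yp n : ptnorm (y n) (p n).1 = q n.
  by have [_ pn _] := pP n; rewrite ptnormZ pn mulr1 ger0_norm// ltW.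
have sS n : s n.+1 = if ptnorm (y n) (p n).1 <= ptnorm (s n + y n) (p n).1
    then s n + y n else s n - y n by [].
have s_ge n : q n <= ptnorm (s n.+1) (p n).1.
  rewrite -yp sS; case: ifPn => // /negbTE h.
  by have := ptnorm_sign (s n) (y n) (p n).1; rewrite h.
(* The tail sum of the bounds [2 * q k] on the terms [y k], whose ratio is [1/4]. *)
pose b n := 8/3 * q n.
have [n|n|d d0|n w|x xs] := @ptnorm_complete _ _ _ s b.
- by rewrite mulr_ge0 ?(ltW (q0 n))//; lra.
- by rewrite /b qS; have := q0 n; lra.
- have c0 : 0 < 8/3 :> R by lra.
  have [n hn] := geometric_small c0 d0; exists n.
  apply: le_lt_trans hn; rewrite /b ler_wpM2l ?(ltW c0)// /q exprVn.
  by rewrite lef_pV2 ?posrE ?exprn_gt0// lerXn2r ?nnegrE//; lra.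
- have -> : ptnorm (s n.+1 - s n) w = ptnorm (y n) w.
    rewrite sS; case: ifP => _; first by rewrite addrAC subrr add0r.
    by rewrite addrAC subrr add0r ptnormN.
  have [_ _ /(_ w) pn] := pP n.
  rewrite ptnormZ ger0_norm ?(ltW (q0 n))// /b qS.
  have : q n * ptnorm (p n).2 w <= q n * 2 by rewrite ler_wpM2l// ltW.
  lra.
(* The terms after the [n]-th add up to at most [b n.+1 = 2/3 * q n], against at least [q n] for
   [s n.+1]. *)
have x_ge n : q n / 3 <= ptnorm x (p n).1.
  have := ptnorm_ler_dist (s n.+1) x (p n).1; rewrite ptnormB.
  have := s_ge n; have := xs n.+1 (p n).1; rewrite /b qS; lra.
have [M HM] := sqnorm_bounded (theta x).
have M1 : 0 < 9 * (`|M| + 1) by rewrite mulr_gt0// ltr_wpDl.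
have [n hn] := geometric_small M1 ltr01.
have := HM (p n).1; apply/negP; rewrite -ltNge sqnorm_scaling.
have [pn _ _] := pP n.
have x2 : q n ^+ 2 / 9 <= sqnorm x (p n).1.
  rewrite -sqr_ptnorm (_ : _ / 9 = (q n / 3) ^+ 2); last by rewrite expr_div_n -natrX.
  by rewrite ler_sqr ?nnegrE ?ptnorm_ge0 ?divr_ge0 ?(ltW (q0 n)).
(* The factor [64^n] beats [q n ^+ 2 = 16^-n] and leaves [4^n / 9], which exceeds [M]. *)
apply: (@lt_le_trans _ _ ((4 ^+ n) ^+ 3 * (q n ^+ 2 / 9))).
  have -> : (4 ^+ n) ^+ 3 * (q n ^+ 2 / 9) = 4 ^+ n / 9.
    by rewrite /q; field; rewrite expf_neq0.
  rewrite ltr_pdivlMr//.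
  move: hn; rewrite exprVn ltr_pdivrMr ?exprn_gt0// mul1r => hn.
  have : 2 ^+ n <= 4 ^+ n :> R by rewrite lerXn2r ?nnegrE//; lra.
  by have := ler_norm M; lra.
by rewrite ler_pM ?divr_ge0 ?exprn_ge0 ?(ltW (q0 n)) ?(ltW pn).
Qed.

Lemma fibrewise_bounded : bounded_module_hom theta.
Proof.
split; first exact: fibrewise_act.
have [M HM] := scaling_bounded.
exists (Num.sqrt M) => x; rewrite -(ge0_ReK (normr_ge0 x)) -rmorphM/=.
have x0 : 0 <= complex.Re `|x| by rewrite -ler0c ge0_ReK.
apply: norm_le_ptnorm => [|w]; first by rewrite mulr_ge0// sqrtr_ge0.
rewrite /ptnorm sqnorm_scaling sqrtrM ?scaling_ge0//.
apply: ler_pM; rewrite ?sqrtr_ge0 ?ler_wsqrtr//.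
by rewrite -lecR ge0_ReK// ptnorm_le_norm.
Qed.

End fibrewise_maps.

Lemma linear_bundle (K : nzRingType) (V W : lmodType K) (f : V -> W) :
  linear f -> exists g : {linear V -> W}, g =1 f.
Proof.
move=> lf; pose fM := GRing.isLinear.Build _ _ _ _ f lf.
by pose g : {linear V -> W} := HB.pack f fM; exists g.
Qed.

(** * Division of [theta] by the square root of its scaling factor *)

Section polar_decomposition.
Variables (R : realType) (Omega : topologicalType).
Variables (E F : hilbertC0ModType R Omega) (theta : {linear E -> F}).
Hypothesis theta_null : forall (e : E) w, e \in nullspace w -> theta e \in nullspace w.
Hypothesis theta_orth : orthogonality_preserving theta.

(** Off [map_support theta] both [psi w] and, by convention, [(psi w)^-1] are [0], so formulas with
    the inverse make sense at every point. *)
Let psi w := Num.sqrt (scaling theta w).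

Let psi_ge0 w : 0 <= psi w. Proof. exact: sqrtr_ge0. Qed.

Let ptnorm_theta (e : E) w : ptnorm (theta e) w = psi w * ptnorm e w.
Proof. by rewrite /ptnorm sqnorm_scaling// sqrtrM// scaling_ge0. Qed.

Lemma map_support_scaling w : map_support theta w <-> scaling theta w != 0.
Proof.
split=> [[e]|/[dup] sw /scaling_neq0[e e0]].
  rewrite evalf_eq0 in_nullspace sqnorm_scaling//.
  by apply: contra_neq => ->; rewrite mul0r.
by exists e; rewrite evalf_eq0 in_nullspace sqnorm_scaling// mulf_neq0.
Qed.

Let psi_off w : ~ map_support theta w -> psi w = 0.
Proof.
move=> h; rewrite /psi; have [->|/map_support_scaling//] := eqVneq (scaling theta w) 0.
exact: sqrtr0.
Qed.

(* Where [sqnorm e >= d^2] (a compact subset of the support of [theta])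
   [sqnorm (theta e)] is bounded below, so [sqrt (N P) / (P + eps)] with
   [N = sqnorm e] and [P = sqnorm (theta e)] approximates [1 / psi]. *)
Lemma isometric_part (e : E) : e \in vanishing_off (map_support theta) ->
  exists y : F, forall w, y - (psi w)^-1%:C%C *: theta e \in nullspace w.
Proof.
move=> /asboolP e_off; apply: uniform_section => d d0.
pose N := sqnorm e; pose P := sqnorm (theta e).
have d20 : 0 < d ^+ 2 by rewrite exprn_gt0.
have [K0 cK0 K0P] := sqnorm_small e d20.
pose K := K0 `&` [set w | d ^+ 2 <= N w].
have [c c0 cP] : exists2 c, 0 < c & forall w, K w -> c <= P w.
  have cK : compact K.
    apply: compact_closedI => //.
    apply: (@preimage_closed _ _ N [set r | d ^+ 2 <= r]); last exact: closed_ge.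
    by move=> w _; exact: continuous_sqnorm.
  have [KE|/set0P Kn] := eqVneq K set0; first by exists 1 => // w; rewrite KE.
  have [|k /set_mem[_ /= kN] kmin] := @compact_EVT_min _ _ P _ Kn cK.
    by apply: continuous_subspaceT; exact: continuous_sqnorm.
  exists (P k) => [|w Kw]; last by apply: kmin; exact/mem_set.
  have Nk : 0 < N k by exact: lt_le_trans kN.
  (* A point of [K] lies in [map_support theta], since [e] is non-null there and vanishes off that
     set. *)
  rewrite /P sqnorm_scaling// mulr_gt0// lt_def scaling_ge0 andbT.
  apply/map_support_scaling; apply: contrapT => h; move: (e_off _ h) => /eqP.
  by rewrite evalf_eq0 in_nullspace gt_eqF.
have [M HM] := sqnorm_bounded e; have [B HB] := scaling_bounded theta_null theta_orth.
have M1 : 0 < 1 + `|M| by rewrite ltr_pwDl.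
(* As [M] bounds the square of [ptnorm e], the denominator bounds [ptnorm e]; hence
   [eps * ptnorm e w <= d * c]. *)
pose eps := c * d / (1 + `|M|).
have eps0 : 0 < eps by rewrite divr_gt0// mulr_gt0.
have Pe w : 0 < P w + eps by rewrite ltr_wpDl// sqnorm_ge0.
have NP w : Num.sqrt (N w * P w) = psi w * N w.
  rewrite /P sqnorm_scaling// mulrCA sqrtrM ?scaling_ge0// -expr2 sqrtr_sqr.
  by rewrite ger0_norm ?sqnorm_ge0.
(* The numerator equals [psi w * N w]; as the root of [N w * P w] it is visibly continuous
   everywhere, while continuity of [psi] is established only where some element is non-null. *)
have [w|w|a aE] := @C0_real _ _ _ e (fun w => Num.sqrt (N w * P w) / (P w + eps))
    (Num.sqrt B / eps).
- apply: cvgM.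
    apply: (@continuous_comp _ _ _ (N \* P) Num.sqrt); last exact: sqrt_continuous.
    by apply: cvgM; exact: continuous_sqnorm.
  apply: cvgV; first by rewrite gt_eqF.
  by apply: cvgD; [exact: continuous_sqnorm | exact: cvg_cst].
- rewrite NP ger0_norm ?divr_ge0 ?mulr_ge0 ?sqnorm_ge0 ?(ltW (Pe w))//.
  rewrite [leRHS]mulrAC ler_pM ?invr_ge0 ?mulr_ge0 ?sqnorm_ge0 ?(ltW (Pe w))//.
    by rewrite ler_wpM2r ?sqnorm_ge0// ler_wsqrtr.
  by rewrite lef_pV2 ?posrE// lerDr sqnorm_ge0.
exists (act (theta e) a) => w.
have /ptnorm_nullB -> : act (theta e) a - (psi w)^-1%:C%C *: theta e
    - ((Num.sqrt (N w * P w) / (P w + eps) - (psi w)^-1)%:C%C *: theta e)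
    \in nullspace w.
  by rewrite rmorphB/= scalerBl opprB addrA subrK -aE act_nullB.
rewrite ptnormZ ptnorm_theta NP.
have [p0|p0] := eqVneq (psi w) 0; first by rewrite p0 !mul0r mulr0 ltW.
have pgt0 : 0 < psi w by rewrite lt_def p0 psi_ge0.
have PE : P w = psi w ^+ 2 * ptnorm e w ^+ 2.
  by rewrite /P -sqr_ptnorm ptnorm_theta exprMn.
have -> : psi w * N w / (P w + eps) - (psi w)^-1 = - (eps / (P w + eps) / psi w).
  move: (Pe w); rewrite PE /N -sqr_ptnorm => /gt_eqF/negbT h; field.
  by rewrite p0 exprMn h.
rewrite normrN (ger0_norm (divr_ge0 (divr_ge0 (ltW eps0) (ltW (Pe w))) (psi_ge0 w))).
rewrite mulrA divfK// mulrAC ler_pdivrMr//.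
have n0 := ptnorm_ge0 e w; have P0 := sqnorm_ge0 (theta e) w : 0 <= P w.
(* The error is [eps * ptnorm e w / (P w + eps)]. It is at most [d] where [ptnorm e w <= d], and on
   [K] by the choice of [eps] and [c <= P w]. *)
have [Nd|Nd] := ltP (N w) (d ^+ 2).
  have nd : ptnorm e w <= d.
    by rewrite -ler_sqr ?nnegrE ?(ltW d0)// sqr_ptnorm ltW.
  by rewrite mulrDr mulrC ler_wpDl ?mulr_ge0 ?(ltW d0)// ler_wpM2r ?(ltW eps0).
have cw : c <= P w.
  by apply: cP; split=> //; apply: contrapT => /K0P; rewrite ltNge Nd.
have nM : ptnorm e w <= 1 + `|M|.
  have := HM w; rewrite -sqr_ptnorm; have := ler_norm M; nra.
have eps_n : eps * ptnorm e w <= d * c.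
  rewrite /eps mulrAC ler_pdivrMr// [d * c]mulrC.
  by rewrite ler_wpM2l ?mulr_ge0 ?(ltW c0) ?(ltW d0).
have dcP : d * c <= d * P w by rewrite ler_wpM2l// ltW.
have deps : 0 < d * eps by rewrite mulr_gt0.
by rewrite mulrDr; lra.
Qed.

(** The map is defined on representatives, and [theta_null] makes the choice irrelevant. It is
    isometric since [theta] multiplies norms in the fibre at [w] by [psi w], which is non-zero. *)
Lemma fibre_isometry_exists w : map_support theta w ->
  exists Jw : {linear fibre E w -> fibre F w},
    (forall e : E, Jw (evalf w e) = (psi w)^-1%:C%C *: evalf w (theta e)) /\
    fibre_isometry Jw.
Proof.
move=> /map_support_scaling sw.
have p0 : psi w != 0 by rewrite sqrtr_eq0 -ltNge lt_def sw scaling_ge0.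
pose j (u : fibre E w) := (psi w)^-1%:C%C *: evalf w (theta (repr u)).
have jE e : j (evalf w e) = (psi w)^-1%:C%C *: evalf w (theta e).
  congr (_ *: _); apply/eqP; rewrite evalf_eq -linearB; apply: theta_null.
  by rewrite -evalf_eq evalfK.
have jl : linear j.
  by move=> k u v; rewrite -[u]evalfK -[v]evalfK -linearP !jE !linearP.
have [J JE] := linear_bundle jl.
exists J; split=> [e|u v]; first by rewrite JE jE.
rewrite -linearB; set z := u - v; rewrite -(evalfK z) JE jE -linearZZ.
rewrite /fibre_norm !fibre_innerE !inner_sqnorm sqnormZ sqnorm_scaling//.
by rewrite exprVn sqr_sqrtr ?scaling_ge0// mulKf.
Qed.

(** The values of [J e] in all fibres are prescribed and determine it, so linearity and the module
    law reduce to identities in the fibres. No fibre norm increases, whence the bound [1]. *)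
Lemma polar_decomposition : exists J : {linear submodule E (map_support theta) ->
                                               submodule F (map_support theta)},
  bounded_submodule_hom J /\
  forall e w, evalf w (val (J e)) = (psi w)^-1%:C%C *: evalf w (theta (val e)).
Proof.
have /choice[j jE] (e : submodule E (map_support theta)) :
    exists y : submodule F (map_support theta),
    forall w, evalf w (val y) = (psi w)^-1%:C%C *: evalf w (theta (val e)).
  have [y yE] := isometric_part (submoduleP e).
  have {}yE w : evalf w y = (psi w)^-1%:C%C *: evalf w (theta (val e)).
    by apply/eqP; rewrite -linearZZ evalf_eq yE.
  have yU : y \in vanishing_off (map_support theta).
    by apply/asboolP => w /psi_off p0; rewrite yE p0 invr0 scale0r.
  by exists (Submodule yU).
have jl : linear j.
  move=> k x y; apply/val_inj/evalf_inj => w.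
  by rewrite jE !linearP/= !jE.
have [J JE] := linear_bundle jl.
exists J; split; last by move=> e w; rewrite JE.
split=> [e a _|].
  apply/val_inj/evalf_inj => w; rewrite !JE jE /= fibrewise_act// !evalf_act jE.
  by rewrite !scalerA mulrC.
exists 1 => e; rewrite mul1r -(ge0_ReK (normr_ge0 (val e))).
apply: norm_le_ptnorm => [|w]; first by rewrite -ler0c ge0_ReK.
have /ptnorm_nullB -> : val (J e) - (psi w)^-1%:C%C *: theta (val e) \in nullspace w.
  by rewrite -evalf_eq JE jE linearZZ.
rewrite ptnormZ ptnorm_theta ger0_norm ?invr_ge0 ?psi_ge0//.
rewrite (@le_trans _ _ (ptnorm (val e) w))//; last first.
  by rewrite -lecR ge0_ReK// ptnorm_le_norm.
have [->|p0] := eqVneq (psi w) 0; first by rewrite invr0 mul0r ptnorm_ge0.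
by rewrite mulKf.
Qed.

End polar_decomposition.

Theorem theorem3p5 (R : realType) (Omega : topologicalType)
    (Omega_lc : locally_compact [set: Omega]) (Omega_T2 : hausdorff_space Omega)
    (E F : hilbertC0ModType R Omega) (theta : {linear E -> F})
    (theta_orth : orthogonality_preserving theta) (theta_local : local_map theta) :
  [/\ (* (a) *)
      bounded_module_hom theta,
      (* (b) *)
      exists phi : Omega -> R,
        [/\ forall w, 0 <= phi w,
            exists M : R, forall w, phi w <= M,
            {within mod_support E, continuous phi} &
            forall (e g : E) (w : Omega),
              inner (theta e) (theta g) w = (phi w)%:C%C * inner e g w]
    & (* (c) *)
      exists (psi0 : Omega -> R)
             (J : {linear submodule E (map_support theta) ->
                          submodule F (map_support theta)}),
        [/\ forall w, map_support theta w -> 0 < psi0 w,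
            exists M : R, forall w, map_support theta w -> psi0 w <= M,
            {within map_support theta, continuous psi0},
            bounded_submodule_hom J &
            forall w, map_support theta w ->
              exists Jw : {linear fibre E w -> fibre F w},
                [/\ is_fibre_map J Jw,
                    fibre_isometry Jw &
                    forall e : E,
                      evalf w (theta e) = (psi0 w)%:C%C *: Jw (evalf w e)]]].
Proof.
have theta_null := local_null Omega_lc Omega_T2 theta_local.
have [M HM] := scaling_bounded theta_null theta_orth.
split; first exact: fibrewise_bounded.
  exists (scaling theta); split.
  - exact: scaling_ge0.
  - by exists M.
  - apply: continuous_in_subspaceT => w /set_mem[u u0].
    apply: (continuous_scaling theta_null theta_orth (e := repr u)).
    by rewrite -in_nullspace -evalf_eq0 evalfK.
  - exact: inner_scaling.
have [J [J_bounded JE]] := polar_decomposition theta_null theta_orth.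
exists (fun w => Num.sqrt (scaling theta w)), J; split => //.
- move=> w /(map_support_scaling theta_null theta_orth) sw.
  by rewrite sqrtr_gt0 lt_def sw scaling_ge0.
- by exists (Num.sqrt M) => w _; rewrite ler_wsqrtr.
- apply: continuous_in_subspaceT => w /set_mem.
  move=> /(map_support_scaling theta_null theta_orth)/scaling_neq0[e e0].
  apply: (@continuous_comp _ _ _ (scaling theta) Num.sqrt).
    exact: (continuous_scaling theta_null theta_orth e0).
  exact: sqrt_continuous.
- move=> w Uw; have [Jw [JwE Jw_iso]] := fibre_isometry_exists theta_null theta_orth Uw.
  exists Jw; split=> // e; first by rewrite JwE JE.
  move: Uw => /(map_support_scaling theta_null theta_orth) sw.
  rewrite JwE scalerA -rmorphM mulfV ?rmorph1 ?scale1r//.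
  by rewrite sqrtr_eq0 -ltNge lt_def sw scaling_ge0.
Qed.
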